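(* Let $\mathbf{k}$ be a multi-index with $\operatorname{wt}(\mathbf{k})=-1$, and set $n:=|\mathbf{k}|$. Then $$J_{\mathbf{k}}=\frac{(n-1)!}{\prod_{a\in A}\prod_{j\ge -1}\big((j+1)!\big)^{k_j^a}}.$$
   Context: $A$ is a finite set (of decorations) and $I_A:=A\times\mathbb{Z}_{\ge -1}$. A multi-index is a finitely supported map $\mathbf{k}:I_A\to\mathbb{Z}_{\ge 0}$, written $k_j^a:=\mathbf{k}(a,j)$; set $|\mathbf{k}|=\sum_{a,j}k_j^a$ and $\operatorname{wt}(\mathbf{k})=\sum_{a,j}j\,k_j^a$ (sums over $a\in A$, $j\ge -1$). The symmetry factor of the monomial $\mathbf{x}^{\mathbf{k}}=\prod_{a,j}(x_j^a)^{k_j^a}$ is $\sigma(\mathbf{x}^{\mathbf{k}}):=\prod_{a,j}k_j^a!$. An $A$-decorated rooted tree is a finite rooted tree $t$ with a map $d:V(t)\to A$; isomorphisms preserve the root and the decorations. The fertility $f(v)$ of a vertex $v$ is its number of children. The profile of $t$ is the multi-index $\mathbf{k}(t)$ with $k_j^a(t)=\#\{v\in V(t): d(v)=a,\ f(v)=j+1\}$. Let $\mathcal{F}_{\mathbf{k}}$ be the (finite) set of isomorphism classes of $A$-decorated rooted trees with profile $\mathbf{k}$; put $\sigma(t):=|\operatorname{Aut}(t)|$ and $$J_{\mathbf{k}}:=\sum_{t\in\mathcal{F}_{\mathbf{k}}}\frac{\sigma(\mathbf{x}^{\mathbf{k}})}{\sigma(t)}.$$ *)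

(* Defs.v *)
From HB Require Import structures.
From mathcomp Require Import all_boot all_order all_algebra all_fingroup.
From mathcomp Require Import finmap.

Set Implicit Arguments.
Unset Strict Implicit.
Unset Printing Implicit Defensive.

Import GRing.Theory Num.Theory.

(** * Multi-indices *)

(* Z_{>= -1} *)
Definition level := {j : int | (-1 <= j)%R}.

Definition multiindex (A : finType) := {fsfun A * level -> nat with 0}.

(* j + 1, as a natural number: the fertility associated with the level j *)
Definition level_succ (j : level) : nat := `|(val j + 1)%R|%N.

Section MultiIndex.
Variable A : finType.
Implicit Types k : multiindex A.

(* Only the indices where k is nonzero contribute to the sums and products
   below, hence the restriction to the support. *)
Definition mi_size k : nat := \sum_(i <- finsupp k) k i.

Definition mi_wt k : int := (\sum_(i <- finsupp k) val i.2 * (k i)%:Z)%R.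

Definition mi_sigma k : nat := \prod_(i <- finsupp k) (k i)`!.

End MultiIndex.

(** * Decorated rooted trees *)

(* The edges are oriented away from the root: (u, v) is an edge when v is a
   child of u. *)
Definition is_rooted_tree (V : finType) (r : V) (E : {set V * V}) : bool :=
  [&& [forall u, (u, r) \notin E],
      [forall v, (v != r) ==> (#|[set u | (u, v) \in E]| == 1)]
    & [forall v, connect [rel x y | (x, y) \in E] r v]].

Record dtree (A V : finType) := DTree {
  dtree_data : V * {set V * V} * {ffun V -> A};
  dtree_axiom : is_rooted_tree dtree_data.1.1 dtree_data.1.2 }.

HB.instance Definition _ (A V : finType) :=
  [isSub for @dtree_data A V].
HB.instance Definition _ (A V : finType) :=
  [Finite of dtree A V by <:].

Section Trees.
Variable A : finType.

Definition root (V : finType) (t : dtree A V) : V := (dtree_data t).1.1.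
Definition edge (V : finType) (t : dtree A V) : rel V :=
  [rel u v | (u, v) \in (dtree_data t).1.2].
Definition deco (V : finType) (t : dtree A V) : V -> A := (dtree_data t).2.

Definition fertility (V : finType) (t : dtree A V) (v : V) : nat :=
  #|[set w | edge t v w]|.

Lemma level_subproof (m : nat) : (-1 <= m%:Z - 1 :> int)%R.
Proof. by rewrite -[X in (X <= _)%R]add0r lerD2r. Qed.

(* The level m - 1 of the vertices of fertility m. *)
Definition level_of (m : nat) : level := exist _ (m%:Z - 1)%R (level_subproof m).

Definition vindex (V : finType) (t : dtree A V) (v : V) : A * level :=
  (deco t v, level_of (fertility t v)).

Definition profile (V : finType) (t : dtree A V) : multiindex A :=
  [fsfun i in [fset vindex t v | v in V]%fset => #|[set v | vindex t v == i]|].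

Definition is_iso (V W : finType) (t : dtree A V) (s : dtree A W) (f : V -> W) :
    bool :=
  [&& injectiveb f, [forall w, w \in codom f],
      f (root t) == root s,
      [forall u, forall v, edge s (f u) (f v) == edge t u v]
    & [forall v, deco s (f v) == deco t v]].

Definition isomorphic (V W : finType) (t : dtree A V) (s : dtree A W) : bool :=
  [exists f : {ffun V -> W}, is_iso t s f].

Definition Aut_tree (V : finType) (t : dtree A V) : {set {perm V}} :=
  [set p : {perm V} | is_iso t t p].

Definition tree_sigma (V : finType) (t : dtree A V) : nat := #|Aut_tree t|.

(* One representative for each isomorphism class of decorated rooted trees of
   profile k. A tree of profile k has mi_size k vertices, so the vertex set may
   be taken to be 'I_(mi_size k): see tree_classesP. *)
Definition tree_classes (k : multiindex A) : {set dtree A 'I_(mi_size k)} :=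
  let D := [set t : dtree A 'I_(mi_size k) | profile t == k] in
  transversal (equivalence_partition (fun t s => isomorphic t s) D) D.

Definition J (k : multiindex A) : rat :=
  (\sum_(t in tree_classes k) (mi_sigma k)%:R / (tree_sigma t)%:R)%R.

Lemma isoP (V W : finType) (t : dtree A V) (s : dtree A W) (f : V -> W) :
  reflect [/\ bijective f, f (root t) = root s,
              forall u v, edge s (f u) (f v) = edge t u v
            & forall v, deco s (f v) = deco t v]
          (is_iso t s f).
Proof.
apply: (iffP and5P) => [[/injectiveP fI fS /eqP fr fe fd]|[fB fr fe fd]].
  split=> //.
  - have fS' w : exists v, f v == w.
      by have /forallP/(_ w)/codomP[v ->] := fS; exists v.
    exists (fun w => xchoose (fS' w)) => [v|w]; last by apply/eqP/(xchooseP (fS' w)).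
    by apply: fI; apply/eqP/(xchooseP (fS' (f v))).
  - by move=> u v; apply/eqP; move/forallP/(_ u)/forallP: fe.
  - by move=> v; apply/eqP; move/forallP: fd.
have [g fK gK] := fB; split.
- by apply/injectiveP/(can_inj fK).
- by apply/forallP => w; rewrite -[w]gK codom_f.
- exact/eqP.
- by apply/forallP => u; apply/forallP => v; apply/eqP.
- by apply/forallP => v; apply/eqP.
Qed.

Lemma isomorphicP (V W : finType) (t : dtree A V) (s : dtree A W) :
  reflect (exists f, is_iso t s f) (isomorphic t s).
Proof.
apply: (iffP existsP) => [[f Hf]|[f /isoP[[g fK gK] fr fe fd]]]; first by exists f.
exists (finfun f); apply/isoP; split=> [|||v]; rewrite ?ffunE //.
- by exists g => x; rewrite ffunE.
- by move=> u v; rewrite !ffunE.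
Qed.

Lemma isomorphic_refl (V : finType) (t : dtree A V) : isomorphic t t.
Proof. by apply/isomorphicP; exists id; apply/isoP; split=> //; exists id. Qed.

Lemma isomorphic_sym (V W : finType) (t : dtree A V) (s : dtree A W) :
  isomorphic t s -> isomorphic s t.
Proof.
move/isomorphicP=> [f /isoP[[g fK gK] fr fe fd]].
apply/isomorphicP; exists g; apply/isoP; split.
- by exists f.
- by rewrite -fr fK.
- by move=> u v; rewrite -fe !gK.
- by move=> v; rewrite -fd gK.
Qed.

Lemma isomorphic_trans (U V W : finType) (r : dtree A U) (t : dtree A V)
    (s : dtree A W) : isomorphic r t -> isomorphic t s -> isomorphic r s.
Proof.
move=> /isomorphicP[f /isoP[fB fr fe fd]] /isomorphicP[g /isoP[gB gr ge gd]].
apply/isomorphicP; exists (g \o f); apply/isoP; split=> /=.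
- exact: bij_comp.
- by rewrite fr.
- by move=> u v; rewrite ge.
- by move=> v; rewrite gd.
Qed.

Lemma profileE (V : finType) (t : dtree A V) (a : A) (j : level) :
  profile t (a, j) =
  #|[set v | (deco t v == a) && ((fertility t v)%:Z == val j + 1 :> int)%R]|.
Proof.
have -> : profile t (a, j) = #|[set v | vindex t v == (a, j)]|.
  rewrite /profile fsfun_fun; case: imfsetP => //= nV.
  apply/esym/eqP; rewrite cards_eq0; apply/eqP/setP => v; rewrite !inE.
  by apply/negP => /eqP e; apply: nV; exists v.
apply: eq_card => v; rewrite !inE xpair_eqE; congr andb.
by rewrite -val_eqE /= subr_eq.
Qed.

Lemma isomorphic_profile (V W : finType) (t : dtree A V) (s : dtree A W) :
  isomorphic t s -> profile t = profile s.
Proof.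
move=> /isomorphicP[f /isoP[fB fr fe fd]]; have [g fK gK] := fB.
apply/fsfunP => -[a j]; rewrite !profileE -(card_imset _ (can_inj fK)).
have ferE v : fertility s (f v) = fertility t v.
  rewrite /fertility -(card_imset _ (can_inj fK)); apply: eq_card => w.
  by rewrite !inE -[w]gK mem_imset ?inE ?fe //; apply: can_inj fK.
apply: eq_card => w; rewrite -[w]gK mem_imset ?inE ?fd ?ferE //.
exact: can_inj fK.
Qed.

Lemma mi_size_profile (V : finType) (t : dtree A V) :
  mi_size (profile t) = #|V|.
Proof.
have pE i : profile t i = \sum_(v : V) (vindex t v == i).
  case: i => a j; rewrite profileE -sum1dep_card big_mkcond /=.
  apply: eq_bigr => v _; rewrite xpair_eqE -[X in _ = nat_of_bool (_ && X)]val_eqE.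
  by rewrite /= subr_eq; case: ifP.
rewrite /mi_size (eq_bigr _ (fun i _ => pE i)) exchange_big /= -sum1_card.
apply: eq_bigr => v _.
have vF : vindex t v \in finsupp (profile t).
  by rewrite mem_finsupp pE (bigD1 v) //= eqxx.
rewrite (bigD1_seq (vindex t v)) ?fset_uniq //=.
by rewrite eqxx big1 // => i; rewrite eq_sym => /negPf ->.
Qed.

Lemma dtree_transport (V W : finType) (t : dtree A V) (f : V -> W) :
  bijective f -> exists s : dtree A W, isomorphic t s.
Proof.
case=> g fK gK; case: t => -[[r E] d] tP.
pose E' := [set x : W * W | (g x.1, g x.2) \in E].
have sP : is_rooted_tree (f r) E'.
  case/and3P: (tP) => /= /forallP h1 /forallP h2 /forallP h3; apply/and3P; split.
  - by apply/forallP => w; rewrite inE /= fK.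
  - apply/forallP => w; apply/implyP => wr.
    have /implyP/(_ _)/eqP <- := h2 (g w); last first.
      by apply: contraNneq wr => <-; rewrite gK.
    rewrite -(card_imset _ (can_inj gK)); apply/eqP/eq_card => u.
    by rewrite -[u]fK mem_imset ?inE //=; apply: can_inj gK.
  - apply/forallP => w; case/connectP: (h3 (g w)) => p pP e.
    apply/connectP; exists (map f p); last by rewrite last_map -e gK.
    rewrite path_map; apply: sub_path pP => x y /=.
    by rewrite inE /= !fK.
exists (@DTree A W (f r, E', [ffun w => d (g w)]) sP).
apply/isomorphicP; exists f; apply/isoP; split.
- by exists g.
- by [].
- by move=> u v; rewrite /edge /= inE /= !fK.
- by move=> v; rewrite /deco /= ffunE fK.
Qed.

Theorem tree_classesP (k : multiindex A) :
  [/\ forall t, t \in tree_classes k -> profile t = k,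
      forall t s, t \in tree_classes k -> s \in tree_classes k ->
        isomorphic t s -> t = s
    & forall (V : finType) (t : dtree A V), profile t = k ->
        exists2 s, s \in tree_classes k & isomorphic t s].
Proof.
pose T := dtree A 'I_(mi_size k).
pose D := [set t : T | profile t == k].
pose R : rel T := fun t s => isomorphic t s.
have eqR : {in D & &, equivalence_rel R}.
  move=> x y z _ _ _; split; first exact: isomorphic_refl.
  move=> xy; apply/idP/idP; last exact: isomorphic_trans.
  by apply: isomorphic_trans; apply: isomorphic_sym.
have pD := equivalence_partitionP eqR.
have trX := transversalP pD.
rewrite -/(tree_classes k) in trX.
have sub t : t \in tree_classes k -> t \in D.
  by apply: subsetP; apply: transversal_sub trX.
split.
- by move=> t /sub; rewrite inE => /eqP.
- move=> t s tX sX ts; apply: (pblock_inj trX) => //.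
  apply/eqP; rewrite eq_pblock; last 2 first.
  + by case/and3P: pD.
  + by rewrite (cover_partition pD) sub.
  by rewrite pblock_equivalence_partition ?sub.
- move=> V t tk.
  have cV : #|V| = mi_size k by rewrite -(mi_size_profile t) tk.
  have [|s ts] := @dtree_transport V 'I_(mi_size k) t (cast_ord cV \o enum_rank).
    apply: bij_comp; last exact: enum_rank_bij.
    by exists (cast_ord (esym cV)) => x; rewrite ?cast_ordK ?cast_ordKV.
  have sD : s \in D by rewrite inE -(isomorphic_profile ts) tk.
  have sP : pblock (equivalence_partition R D) s \in equivalence_partition R D.
    by rewrite pblock_mem // (cover_partition pD).
  have xB := repr_mem_pblock trX s sP; have xX := repr_mem_transversal trX s sP.
  exists (transversal_repr s (tree_classes k) (pblock (equivalence_partition R D) s)).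
    exact: xX.
  apply: isomorphic_trans ts _.
  by rewrite pblock_equivalence_partition // ?sub in xB.
Qed.

End Trees.

(* Main.v *)
(* A permutation of the n vertices carries a tree t to exactly one tree, and
   |Aut t| of them carry t to a given isomorphic tree; hence the sum of the
   n! / |Aut t| over the isomorphism classes is the number of labelled trees of
   profile k. To choose such a labelled tree, first choose the decoration and
   fertility of every vertex, which can be done in n! / sigma(x^k) ways, then a
   labelled rooted tree in which the vertex v has c v children. The trees of the
   latter kind number (n-1)! / prod_v (c v)!: by induction on n, removing a fixed
   leaf v0 attached to p leaves the same problem with c p decreased by 1, and the
   numbers so obtained add up as in Pascal's rule for multinomial coefficients. *)

Require Import Defs.
From mathcomp Require Import all_boot all_order all_algebra all_fingroup.
From mathcomp Require Import finmap.

Set Implicit Arguments.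
Unset Strict Implicit.
Unset Printing Implicit Defensive.

Import GRing.Theory Num.Theory.

(** * Lowering a function by one at a single point *)

Lemma sum_decr (I : finType) (c : I -> nat) p :
  0 < c p -> \sum_i c i = (\sum_i (c i - (i == p))).+1.
Proof.
move=> cp; rewrite (bigD1 p) // [in RHS](bigD1 p) //= eqxx subn1 -addSn prednK //.
by congr (_ + _); apply: eq_bigr => i /negPf->; rewrite subn0.
Qed.

(** As [c p] is positive, the truncated subtraction in [c i - (i == p)] is exact. With [sum_decr],
    this drives the two inductions below. *)
Lemma prod_fact_decr (I : finType) (c : I -> nat) p :
  0 < c p -> \prod_i (c i)`! = c p * \prod_i (c i - (i == p))`!.
Proof.
move=> cp; rewrite (bigD1 p) // [in RHS](bigD1 p) //= eqxx subn1 mulnA.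
rewrite -[in LHS](prednK cp) factS prednK //.
by congr (_ * _); apply: eq_bigr => i /negPf->; rewrite subn0.
Qed.

(** * Labelled rooted trees with prescribed outdegrees *)

Section Arborescences.
Variable V : finType.
Implicit Types (S : {set V}) (r u v w p : V) (E : {set V * V}) (c : V -> nat).

Definition erel E : rel V := [rel x y | (x, y) \in E].
Definition outdeg E v := #|[set w | (v, w) \in E]|.

(** The vertex set is a subset [S] of a fixed type, so that a leaf can be deleted without changing
    the type. *)
Definition spans_tree S r E : bool :=
  [&& r \in S, E \subset setX S S, [forall u, (u, r) \notin E],
      [forall v in S, (v != r) ==> (#|[set u | (u, v) \in E]| == 1)]
    & [forall v in S, connect (erel E) r v]].

Lemma spans_treeP S r E :
  reflect [/\ r \in S, forall u v, (u, v) \in E -> (u \in S) && (v \in S),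
              forall u, (u, r) \notin E,
              {in S, forall v, v != r -> exists u, forall w, ((w, v) \in E) = (w == u)}
            & {in S, forall v, connect (erel E) r v}]
          (spans_tree S r E).
Proof.
apply: (iffP and5P) => [[rS /subsetP sE /forallP nr /forall_inP un /forall_inP cn]|].
  split=> // [u v /sE|v vS vr]; first by rewrite inE.
  have /implyP/(_ vr)/cards1P[u e] := un v vS; exists u => w.
  by move/setP/(_ w): e; rewrite !inE.
case=> rS sE nr un cn; split=> //.
- by apply/subsetP=> -[u v] /sE; rewrite inE.
- exact/forallP.
- apply/forall_inP => v vS; apply/implyP => /(un v vS)[u e].
  by apply/cards1P; exists u; apply/setP=> w; rewrite !inE e.
- exact/forall_inP.
Qed.

(** The outdegree condition ranges over all of [V]; outside [S] it amounts to [c v = 0]. *)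
Definition trees_on S c : {set V * {set V * V}} :=
  [set x | spans_tree S x.1 x.2 & [forall v, outdeg x.2 v == c v]].

Lemma trees_onP S c r E :
  reflect (spans_tree S r E /\ outdeg E =1 c) ((r, E) \in trees_on S c).
Proof.
rewrite inE; apply: (iffP andP) => -[-> d]; split=> //.
  by move=> v; apply/eqP/(forallP d).
by apply/forallP => v; apply/eqP/d.
Qed.

Lemma outdeg0 E v w : outdeg E v = 0 -> (v, w) \notin E.
Proof.
by move/eqP; rewrite cards_eq0 => /eqP/setP/(_ w); rewrite !inE => ->.
Qed.

Lemma outdegD1 E p v u :
  (p, v) \in E -> outdeg E u = (u == p) + outdeg (E :\ (p, v)) u.
Proof.
move=> pv; rewrite /outdeg; have [->|up] := eqVneq u p.
  rewrite (cardsD1 v) inE pv; congr (_ + _); apply: eq_card => w.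
  by rewrite !inE xpair_eqE eqxx.
by apply: eq_card => w; rewrite !inE xpair_eqE (negPf up).
Qed.

(** A path that ends elsewhere never visits [v], which has no outgoing edge, so it avoids the edge
    from [p] to [v]. *)
Lemma connect_delete_leaf E p v r w :
  outdeg E v = 0 -> w != v -> connect (erel E) r w ->
  connect (erel (E :\ (p, v))) r w.
Proof.
move=> v0 wv /connectP[s]; elim/last_ind: s w wv => [|s x IH] w wv.
  by move=> _ ->; apply: connect0.
rewrite rcons_path last_rcons => /andP[ps /= e] wx; subst x.
have lv : last r s != v by apply: contraTneq e => ->; apply: outdeg0.
apply: connect_trans (IH _ lv ps erefl) (connect1 _).
by move: e; rewrite /erel /= !inE xpair_eqE (negPf wv) andbF.
Qed.

(** Deleting the edge [(p, v)] removes the leaf [v] and is a bijection; its inverse attaches [v] to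
    [p] again. *)
Lemma card_trees_on_leaf S c p v :
  v \in S -> p \in S -> p != v -> c v = 0 -> 0 < c p ->
  #|[set x in trees_on S c | (p, v) \in x.2]|
  = #|trees_on (S :\ v) (fun u => c u - (u == p))|.
Proof.
move=> vS pS pv cv cp.
pose f (x : V * {set V * V}) := (x.1, x.2 :\ (p, v)).
have fI : {in [set x in trees_on S c | (p, v) \in x.2] &, injective f}.
  move=> [r E] [r' E']; rewrite !(inE, in_setD1) /= => /andP[_ e] /andP[_ e'] [-> eE].
  by rewrite -(setD1K e) eE setD1K.
rewrite -(card_in_imset fI); apply: eq_card => -[r E].
apply/imsetP/trees_onP => [[[r' E0] /setIdP[/trees_onP[/spans_treeP t d] /= e]]|].
  case=> -> ->; case: t => rS sE nr un cn; split; last first.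
    by move=> u; rewrite -d (outdegD1 u e) addKn.
  have rv : r' != v by apply: contraTneq e => <-.
  have ov : outdeg E0 v = 0 by rewrite d.
  apply/spans_treeP; split.
  - by rewrite !inE rv.
  - move=> u w; rewrite !inE xpair_eqE negb_and => /andP[h uw].
    have /andP[-> ->] := sE _ _ uw; rewrite !andbT; apply/andP; split.
      by apply: contraTneq uw => ->; apply: outdeg0.
    (* An edge into [v] starts at its only parent [p], hence is the deleted one. *)
    have [wv|//] := eqVneq w v; subst w.
    have [|u0 hu] := un v vS; first by rewrite eq_sym.
    by move: e uw h; rewrite !hu => /eqP-> ->; rewrite eqxx.
  - by move=> u; rewrite !inE negb_and nr orbT.
  - move=> w /setD1P[wv wS] wr; have [u hu] := un w wS wr; exists u => x.
    by rewrite !inE xpair_eqE (negPf wv) andbF hu.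
  - by move=> w /setD1P[wv wS]; apply: connect_delete_leaf => //; apply: cn.
case=> /spans_treeP[/setD1P[rv rS] sE nr un cn] d.
have nv u : (u, v) \notin E.
  by apply/negP => /sE; rewrite !inE eqxx andbF.
exists (r, (p, v) |: E); last by rewrite /f /= setU1K.
rewrite inE /= setU11 andbT; apply/trees_onP; split; last first.
  move=> u; rewrite (@outdegD1 _ p v u) ?setU11 // setU1K // d.
  by case: eqP => [->|_]; rewrite ?subn0 // subnKC.
apply/spans_treeP; split=> //.
- move=> u w /setU1P[[-> ->]|/sE]; first by rewrite pS.
  by rewrite !inE => /andP[/andP[_ ->] /andP[_ ->]].
- by move=> u; rewrite !inE xpair_eqE (negPf rv) andbF nr.
- move=> w wS wr; have [->|wv] := eqVneq w v.
    by exists p => u; rewrite !inE xpair_eqE eqxx andbT (negPf (nv u)) orbF.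
  have [|u hu] := un w _ wr; first by rewrite !inE wv.
  by exists u => x; rewrite !inE xpair_eqE (negPf wv) andbF hu.
(* Old paths survive in the larger edge set; [v] is then reached through [p]. *)
- have cE w : w \in S -> w != v -> connect (erel ((p, v) |: E)) r w.
    move=> wS wv; apply: connect_sub (cn w _); last by rewrite !inE wv.
    by move=> x y xy; apply: connect1; rewrite /erel /= inE [_ \in E]xy orbT.
  move=> w wS; have [->|] := eqVneq w v; last exact: cE.
  by apply: connect_trans (cE p pS pv) (connect1 _); rewrite /erel /= setU11.
Qed.

(** If the childless vertex [v] were the root, no other vertex could be reached, and [S] would have
    only one element. *)
Lemma trees_on_parent S c v r E :
  1 < #|S| -> v \in S -> c v = 0 -> (r, E) \in trees_on S c ->
  exists u, forall w, ((w, v) \in E) = (w == u).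
Proof.
move=> S2 vS cv /trees_onP[/spans_treeP[rS sE nr un cn] d].
apply: un => //; apply: contraTneq S2 => vr; subst v; rewrite -leqNgt.
apply/card_le1_eqP => x y; have h z : z \in S -> z = r.
  move=> /cn/connectP[[|u s] //= /andP[e _] _].
  by have := @outdeg0 E r u; rewrite d cv => /(_ erefl)/negP; case.
by move=> /h-> /h->.
Qed.

(** Denominators are cleared to stay in [nat]. Since [c] vanishes outside [S], the sum and the
    product may run over all of [V]. *)
Lemma card_trees_on m S c :
    #|S| = m.+1 -> (forall v, v \notin S -> c v = 0) -> \sum_v c v = m ->
  #|trees_on S c| * \prod_v (c v)`! = m`!.
Proof.
elim: m => [|m IH] in S c *.
  move=> /eqP/cards1P[r ->] cS /eqP; rewrite sum_nat_eq0 => /forallP c0.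
  have {c0} c0 v : c v = 0 by apply/eqP/c0.
  rewrite big1 => [|v _]; last by rewrite c0.
  rewrite muln1 fact0 -(cards1 (r, set0 : {set V * V})); apply: eq_card => -[r' E].
  rewrite in_set1 xpair_eqE; apply/trees_onP/andP => [[/spans_treeP[]]|[/eqP-> /eqP->]].
    rewrite inE => -> _ _ _ _ d; split=> //; apply/eqP/setP=> -[u v].
    by rewrite in_set0; apply/negbTE/outdeg0; rewrite d.
  split=> [|v]; last by rewrite c0; apply: eq_card0 => w; rewrite !inE.
  apply/spans_treeP; split=> [|u v|u|v|v]; rewrite ?inE ?eqxx //.
    by move=> ->.
  by move/eqP->; apply: connect0.
move=> Sm cS cm.
(* Otherwise [c] would be at least 1 on each of the [m.+2] vertices, but its total is [m.+1]. *)
have [v vS cv] : exists2 v, v \in S & c v = 0.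
  apply/exists_eq_inP; apply: contraTT (leqnn m.+1) => /exists_inPn h.
  rewrite -ltnNge -[X in X <= _]Sm -[X in _ <= X]cm -sum1_card big_mkcond.
  apply: leq_sum => v _; case: ifP => // vS.
  by rewrite lt0n h.
(* The trees are sorted by the unique parent [p] of [v]. *)
have -> : #|trees_on S c| = \sum_p #|[set x in trees_on S c | (p, v) \in x.2]|.
  rewrite -sum1_card (eq_bigr (fun p => \sum_(x in trees_on S c) ((p, v) \in x.2))).
    rewrite exchange_big; apply: eq_bigr => -[r E] xT.
    have [|u hu] := trees_on_parent _ vS cv xT; first by rewrite Sm.
    by rewrite (bigD1 u) //= hu eqxx big1 // => p /negPf pu; rewrite hu pu.
  move=> p _; rewrite -sum1_card big_mkcond [RHS]big_mkcond; apply: eq_bigr => x _.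
  by rewrite in_set /=; case: (x \in _) => //=; case: ifP.
(* Writing the factor [m.+1] as the sum of the [c p] lets the two sides be compared term by term. *)
rewrite factS -[in RHS]cm !big_distrl; apply: eq_bigr => p _ /=.
have [cp|cp] := posnP (c p).
  rewrite cp mul0n; apply/eqP; rewrite muln_eq0 cards_eq0; apply/orP; left.
  apply/eqP/setP => -[r E]; rewrite !inE; apply/negP => /andP[xT].
  by apply/negP/outdeg0; case/andP: xT => _ /forallP/(_ p)/eqP->.
have pS : p \in S by apply: contraLR cp => /cS->.
have pv : p != v by apply: contraTneq cp => ->; rewrite cv.
rewrite (card_trees_on_leaf vS pS pv cv cp) (prod_fact_decr cp) mulnCA; congr (_ * _).
apply: IH.
- by move: Sm; rewrite (cardsD1 v) vS => -[].
- move=> u; rewrite !inE negb_and negbK => /orP[/eqP->|/cS->] //.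
  by rewrite cv.
- by move: cm; rewrite (sum_decr cp) => -[].
Qed.

End Arborescences.

(** * Multinomial count of sequences with prescribed multiplicities *)

Lemma card_tuples_with_counts (I : finType) n (k : I -> nat) :
  \sum_i k i = n ->
  #|[set s : n.-tuple I | [forall i, count_mem i s == k i]]| * \prod_i (k i)`! = n`!.
Proof.
elim: n => [|n IH] in k *.
  move=> /eqP; rewrite sum_nat_eq0 => /forallP k0.
  rewrite big1 => [|i _]; last by rewrite (eqP (k0 i)).
  rewrite muln1 fact0 -(cards1 ([tuple] : 0.-tuple I)); apply: eq_card => s.
  by rewrite !inE tuple0 eqxx; apply/forallP => i; rewrite /= (eqP (k0 i)).
move=> kn; set T := [set s | _].
(* Sorting by the first entry [i] leaves a shorter sequence with [k i] lowered by one, the same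
   recursion as for trees. *)
have -> : #|T| = \sum_i #|[set s in T | thead s == i]|.
  rewrite -sum1_card (partition_big (@thead _ _) predT) //=.
  by apply: eq_bigr => i _; rewrite -sum1_card; apply: eq_bigl => s; rewrite [in RHS]in_set.
rewrite factS -[in RHS]kn !big_distrl; apply: eq_bigr => i _ /=.
have [ki|ki] := posnP (k i).
  rewrite ki mul0n; apply/eqP; rewrite muln_eq0 cards_eq0; apply/orP; left.
  apply/eqP/setP => s; rewrite !inE; apply/negP => /andP[/forallP/(_ i)].
  by case/tupleP: s => x s; rewrite theadE /= ki => + /eqP e; rewrite e eqxx.
rewrite (prod_fact_decr ki) mulnCA; congr (_ * _).
rewrite -(IH (fun j => k j - (j == i))); last by move: kn; rewrite (sum_decr ki) => -[].
congr (_ * _).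
have cI : injective (fun s : n.-tuple I => [tuple of i :: s]).
  by move=> s s' /(congr1 val)[] /val_inj.
rewrite -(card_imset _ cI); apply: eq_card => s; apply/idP/imsetP.
  case/tupleP: s => x s; rewrite !inE theadE => /andP[/forallP h /eqP e]; subst x.
  exists s => //; rewrite inE; apply/forallP => j; rewrite -(eqP (h j)) /=.
  by rewrite [j == i]eq_sym addKn.
case=> s'; rewrite inE => /forallP h ->; rewrite !inE theadE eqxx andbT.
apply/forallP => j; rewrite /= (eqP (h j)) [j == i]eq_sym.
by have [<-|_] := eqVneq i j; rewrite ?subn0 // subnKC.
Qed.

(** * Permutations acting on labelled trees *)

Section Relabelling.
Variables A V : finType.
Implicit Types (t s : dtree A V) (p : {perm V}).

Lemma is_iso_inj t s s' p : is_iso t s p -> is_iso t s' p -> s = s'.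
Proof.
case: s s' => [[[r E] d] sP] [[[r' E'] d'] sP'].
move=> /isoP[_ rE eE dE] /isoP[_ rE' eE' dE']; apply: val_inj => /=.
move: rE eE dE rE' eE' dE'; rewrite /Defs.root /edge /deco /= => -> eE dE -> eE' dE'.
congr (_, _, _).
  by apply/setP => -[u v]; rewrite -[u](permKV p) -[v](permKV p) eE eE'.
by apply/ffunP => v; rewrite -[v](permKV p) dE dE'.
Qed.

(** [dtree_transport] yields only some isomorphism; here [p] itself must be one. *)
Lemma is_iso_ex t p : exists s, is_iso t s p.
Proof.
case: t => -[[r E] d] tP.
pose E' := [set x : V * V | (p^-1%g x.1, p^-1%g x.2) \in E].
have sP : is_rooted_tree (p r) E'.
  case/and3P: (tP) => /= /forallP h1 /forall_inP h2 /forallP h3; apply/and3P; split.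
  - by apply/forallP => w; rewrite inE /= permK.
  - apply/forall_inP => w wr; rewrite -(eqP (h2 (p^-1%g w) _)).
      apply/eqP; rewrite -[RHS](card_imset _ (@perm_inj _ p)); apply: eq_card => u.
      by rewrite -[u](permKV p) (mem_imset _ _ perm_inj) !inE /= permK.
    by apply: contraNneq wr => <-; rewrite permKV.
  - apply/forallP => w; case/connectP: (h3 (p^-1%g w)) => q pP e.
    apply/connectP; exists (map p q); last by rewrite last_map -e permKV.
    by rewrite path_map; apply: sub_path pP => x y; rewrite /= inE /= !permK.
exists (@DTree A V (p r, E', [ffun w => d (p^-1%g w)]) sP); apply/isoP; split => //.
- exact: injF_bij perm_inj.
- by move=> u v; rewrite /edge /= inE /= !permK.
- by move=> v; rewrite /deco /= ffunE permK.
Qed.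

(** The isomorphisms from [t] to [s] form a coset of [Aut_tree t]: they are the automorphisms
    followed by one fixed isomorphism [q]. *)
Lemma card_isos t s :
  isomorphic t s -> #|[set p : {perm V} | is_iso t s p]| = tree_sigma t.
Proof.
move=> /isomorphicP[f /isoP[fB fr fe fd]].
pose q := perm (bij_inj fB).
have qE v : q v = f v by rewrite permE.
rewrite /tree_sigma -[RHS](card_imset _ (mulIg q)); apply: eq_card => p.
rewrite -[p](mulgKV q) (mem_imset _ _ (mulIg q)) !inE.
move: (p * q^-1)%g => {}p; apply/isoP/isoP => -[_ pr pe pd]; split.
- exact: injF_bij perm_inj.
- by apply: (@perm_inj _ q); rewrite [RHS]qE fr -pr permM.
- by move=> u v; rewrite -fe -!qE -!permM pe.
- by move=> v; rewrite -fd -qE -permM pd.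
- exact: injF_bij perm_inj.
- by rewrite permM pr qE fr.
- by move=> u v; rewrite !permM !qE fe pe.
- by move=> v; rewrite permM qE fd pd.
Qed.

(** Orbit-stabilizer, by counting the pairs of [p] and [s] with [is_iso t s p]: one per permutation,
    and [tree_sigma t] per tree isomorphic to [t]. *)
Lemma card_iso_class t : #|[set s : dtree A V | isomorphic t s]| * tree_sigma t = (#|V|)`!.
Proof.
have -> : (#|V|)`! = \sum_(p : {perm V}) 1.
  rewrite -(cardsT V) -card_perm -sum1_card; apply: eq_bigl => p.
  by rewrite unfold_in; apply/subsetP => v; rewrite in_setT.
rewrite -sum_nat_const (eq_bigr (fun p : {perm V} => \sum_s is_iso t s p)); last first.
  move=> p _; have [s sp] := is_iso_ex t p.
  rewrite (bigD1 s) //= sp big1 // => s' s's.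
  by case: (boolP (is_iso t s' p)) => // /is_iso_inj/(_ sp) e; rewrite e eqxx in s's.
rewrite exchange_big big_mkcond; apply: eq_bigr => s _.
rewrite inE; case: (boolP (isomorphic t s)) => [/card_isos<-|ns].
  by rewrite -sum1_card big_mkcond; apply: eq_bigr => p _; rewrite inE; case: ifP.
rewrite big1 // => p _; case: (boolP (is_iso t s p)) => // sp.
by case/isomorphicP: ns; exists p.
Qed.

End Relabelling.

(** * Levels and fertilities *)

Section Counting.
Variable A : finType.

(** A level is at least -1, so the absolute value in [level_succ] loses nothing. *)
Lemma level_succK : cancel level_succ level_of.
Proof.
move=> j; apply: val_inj; rewrite /= /level_succ gez0_abs ?addrK //.
by have := valP j; rewrite -lerBlDr sub0r.
Qed.

Lemma level_ofK : cancel level_of level_succ.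
Proof. by move=> m; rewrite /level_succ /= subrK. Qed.

Lemma spans_treeT (V : finType) (r : V) E : spans_tree [set: V] r E = is_rooted_tree r E.
Proof.
rewrite /spans_tree /is_rooted_tree in_setT /=.
have -> : E \subset setX setT setT by apply/subsetP => x; rewrite !inE.
by rewrite /=; congr [&& _, _ & _]; apply: eq_forallb => v; rewrite in_setT.
Qed.

Lemma profile_card (V : finType) (t : dtree A V) i :
  profile t i = #|[set v | vindex t v == i]|.
Proof.
rewrite /profile fsfun_fun; case: imfsetP => //= nV.
apply/esym/eqP; rewrite cards_eq0; apply/eqP/setP => v; rewrite !inE.
by apply/negP => /eqP e; apply: nV; exists v.
Qed.

(** * Labelled trees of profile [k] *)

Section Profile.
Variable k : multiindex A.
Let n := mi_size k.
Implicit Type s : n.-tuple (finsupp k).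

(** The tuple [s] assigns a decoration and a level to each vertex; taking its entries in the support
    of [k] makes their type finite. *)
Definition has_counts s := [forall i, count_mem i s == k (val i)].

Lemma count_tnth s i : count_mem i s = #|[set v | tnth s v == i]|.
Proof. by rewrite -sum1_count big_tuple sum1dep_card. Qed.

Lemma card_has_counts : #|[set s | has_counts s]| * mi_sigma k = n`!.
Proof.
rewrite -(@card_tuples_with_counts _ _ (fun i : finsupp k => k (val i))).
  by rewrite /mi_sigma big_seq_fsetE.
by rewrite /n /mi_size big_seq_fsetE.
Qed.

Lemma sum_has_counts s (F : A * level -> nat) : has_counts s ->
  \sum_v F (val (tnth s v)) = \sum_(i <- finsupp k) k i * F i.
Proof.
move=> /forallP h; rewrite big_seq_fsetE (partition_big (tnth s) predT) //=.
apply: eq_bigr => i _; rewrite (eq_bigr (fun _ => F (val i))) => [|v /eqP->] //.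
by rewrite sum_nat_cond_const -(eqP (h i)) count_tnth.
Qed.

Lemma prod_has_counts s (F : A * level -> nat) : has_counts s ->
  \prod_v F (val (tnth s v)) = \prod_(i <- finsupp k) F i ^ k i.
Proof.
move=> /forallP h; rewrite big_seq_fsetE (partition_big (tnth s) predT) //=.
apply: eq_bigr => i _; rewrite (eq_bigr (fun _ => F (val i))) => [|v /eqP->] //.
by rewrite -(eqP (h i)) count_tnth -prod_nat_const; apply: eq_bigl => v; rewrite inE.
Qed.

Lemma vindex_counts (t : dtree A 'I_n) s :
  (forall v, vindex t v = val (tnth s v)) -> (profile t == k) = has_counts s.
Proof.
move=> ts.
have E (i : finsupp k) : profile t (val i) = count_mem i s.
  by rewrite profile_card count_tnth; apply: eq_card => v; rewrite !inE ts.
apply/eqP/forallP => [tk i|h]; first by rewrite -E tk.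
apply/fsfunP => i; case: (boolP (i \in finsupp k)) => ik.
  by have /eqP := h [` ik]%fset; rewrite -E.
rewrite (fsfun_dflt ik) profile_card; apply: eq_card0 => v; rewrite inE ts.
by apply: contraNF ik => /eqP<-; apply: valP.
Qed.

(** Since [s] fixes the decoration, it can be forgotten injectively; what remains of the condition
    is the outdegree of each vertex. *)
Lemma card_trees_indexed s :
  #|[set t : dtree A 'I_n | [forall v, vindex t v == val (tnth s v)]]|
  = #|trees_on setT (fun v => level_succ (val (tnth s v)).2)|.
Proof.
pose f (t : dtree A 'I_n) := (dtree_data t).1.
set D := [set t | _].
have DP t : reflect (forall v, vindex t v = val (tnth s v)) (t \in D).
  by rewrite inE; apply: (iffP forallP) => h v; apply/eqP/h.
have fI : {in D &, injective f}.
  move=> t t' /DP h /DP h' ff; apply: val_inj => /=.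
  case: t t' h h' ff => -[x d] tP [[x' d'] tP'] /= h h'; rewrite /f /= => <-.
  by congr (_, _); apply/ffunP => v; have := h v; rewrite -h' => -[].
rewrite -(card_in_imset fI); apply: eq_card => -[r E].
apply/imsetP/trees_onP => [[[[[r' E'] d] tP] /DP h [-> ->]]|].
  rewrite spans_treeT; split; first exact: tP.
  by move=> v; rewrite -h level_ofK.
rewrite spans_treeT => -[rE d].
exists (@DTree A _ (r, E, [ffun v => (val (tnth s v)).1]) rE) => //.
apply/DP => v; rewrite /vindex /deco /= ffunE /fertility.
by rewrite -[#|_|]/(outdeg E v) d level_succK -surjective_pairing.
Qed.

Lemma card_trees_profile : mi_wt k = (-1)%R ->
  #|[set t : dtree A 'I_n | profile t == k]|
    * (mi_sigma k * \prod_(i <- finsupp k) (level_succ i.2)`! ^ k i)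
  = n`! * n.-1`!.
Proof.
move=> wt; set D := [set t | _].
have sumE : \sum_(i <- finsupp k) k i * level_succ i.2 = n.-1 /\ 0 < n.
  (* The total fertility is [mi_wt k] plus [mi_size k], that is [n] minus 1. The successor form also
     gives [0 < n]. *)
  suff e : (\sum_(i <- finsupp k) k i * level_succ i.2).+1 = n by rewrite -e.
  apply/eqP; rewrite -eqz_nat -addn1 PoszD -subr_eq0; apply/eqP.
  rewrite /n /mi_size !(big_morph Posz PoszD (erefl _)).
  transitivity (mi_wt k + 1)%R; last by rewrite wt.
  rewrite addrAC; congr (_ + _)%R; rewrite -sumrB; apply: eq_bigr => i _.
  rewrite PoszM -[in X in (X * _)%R]/(k i) /level_succ gez0_abs.
    by rewrite mulrDr mulr1 addrK mulrC.
  by have := valP i.2; rewrite -lerBlDr sub0r.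
case: sumE => sumE n0.
(* A tree of profile [k] matches exactly one [s], the tuple of its vertex indices. *)
have -> : #|D| = \sum_(s | has_counts s)
    #|[set t : dtree A 'I_n | [forall v, vindex t v == val (tnth s v)]]|.
  rewrite -sum1_card; rewrite (eq_bigr (fun t : dtree A 'I_n =>
    \sum_(s | has_counts s) [forall v, vindex t v == val (tnth s v)])).
    rewrite exchange_big; apply: eq_bigr => s hs.
    rewrite -sum1_card big_mkcond [RHS]big_mkcond; apply: eq_bigr => t _.
    rewrite !inE; case: (boolP [forall v, _]) => [/forallP h|]; last by case: ifP.
    by rewrite (@vindex_counts t s) ?hs // => v; apply/eqP.
  move=> t; rewrite inE => /eqP tk.
  have vk v : vindex t v \in finsupp k.
    by rewrite mem_finsupp -tk profile_card -lt0n; apply/card_gt0P; exists v; rewrite inE.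
  pose s := [tuple [` vk v]%fset | v < n].
  have sv v : vindex t v = val (tnth s v) by rewrite tnth_mktuple.
  rewrite (bigD1 s) /=; last by rewrite -(vindex_counts sv) tk.
  have -> : [forall v, vindex t v == val (tnth s v)] by apply/forallP => v; rewrite -sv.
  rewrite big1 // => s' /andP[_ s's]; case: (boolP [forall v, _]) => // /forallP h.
  by case/eqP: s's; apply: eq_from_tnth => v; apply: val_inj; rewrite /= -sv -(eqP (h v)).
(* The factorial of [n] becomes the number of tuples times [mi_sigma k], which cancels; each tuple
   must then contribute the factorial of [n.-1]. *)
rewrite -card_has_counts [LHS]mulnCA [RHS]mulnAC [RHS]mulnC; congr (_ * _).
rewrite big_distrl -sum_nat_const /=; apply: eq_big => s; first by rewrite inE.
move=> hs; rewrite card_trees_indexed -(prod_has_counts (fun i => (level_succ i.2)`!) hs).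
apply: card_trees_on; first by rewrite cardsT card_ord prednK.
  by move=> v; rewrite in_setT.
by rewrite (sum_has_counts (fun i => level_succ i.2) hs).
Qed.

(** Every labelled tree of profile [k] is isomorphic to exactly one representative, and isomorphic
    trees share their profile. *)
Lemma sum_tree_classes :
  \sum_(t in tree_classes k) #|[set s : dtree A 'I_n | isomorphic t s]|
  = #|[set t : dtree A 'I_n | profile t == k]|.
Proof.
have [ck cI cE] := tree_classesP k.
rewrite -[RHS]sum1_card.
rewrite [RHS](eq_bigr (fun s : dtree A 'I_n => \sum_(t in tree_classes k) isomorphic t s)); last first.
  move=> s; rewrite inE => /eqP/cE[t tX st].
  rewrite (bigD1 t) //= (isomorphic_sym st) big1 // => t' /andP[t'X].
  by apply: contraNeq; rewrite eqb0 negbK => t's; apply/eqP/cI => //;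
  apply: isomorphic_trans t's st.
rewrite exchange_big; apply: eq_bigr => t tX /=.
rewrite -sum1_card big_mkcond [RHS]big_mkcond; apply: eq_bigr => s _.
rewrite !in_set; case: (boolP (isomorphic t s)) => [ts|]; last by case: ifP.
by rewrite -(isomorphic_profile ts) ck // eqxx.
Qed.

End Profile.

End Counting.

(** * The closed formula for [J k] *)

Local Open Scope ring_scope.

Theorem corollary3p5 (A : finType) (k : multiindex A) (n : nat) :
  mi_wt k = - 1 ->
  n = mi_size k ->
  J k = ((n - 1)`!)%:R
        / (\prod_(i <- finsupp k) (level_succ i.2)`! ^ k i)%N%:R.
Proof.
move=> wt ->; set P := (\prod_(i <- _) _)%N; set m := mi_size k.
have mf : (m`!)%:R != 0 :> rat by rewrite pnatr_eq0 -lt0n fact_gt0.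
have Pf : P%:R != 0 :> rat.
  rewrite pnatr_eq0 -lt0n /P big_seq_cond prodn_cond_gt0 // => i _.
  by rewrite expn_gt0 fact_gt0.
(* By [card_iso_class], the inverse of [tree_sigma t] is the size of the class of [t] divided by the
   factorial of [m]. *)
have -> : J k = (mi_sigma k)%:R
    * (#|[set t : dtree A 'I_m | profile t == k]|)%:R / (m`!)%:R.
  rewrite -sum_tree_classes natr_sum mulr_sumr mulr_suml; apply: eq_bigr => t _.
  have := card_iso_class t; rewrite card_ord -/m => e.
  have tf : (tree_sigma t)%:R != 0 :> rat.
    by rewrite pnatr_eq0; apply: contraNneq mf => t0; rewrite -e t0 muln0.
  by apply/eqP; rewrite eqr_div // -e natrM mulrA.
(* Cross-multiplying turns the claim into the identity [card_trees_profile] in [nat]. *)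
apply/eqP; rewrite eqr_div // -!natrM eqr_nat subn1 [eqbRHS]mulnC.
by rewrite -card_trees_profile // mulnCA mulnA.
Qed.
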